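(* Let $N\ge3$, and let $\Omega=\mathbb{R}^N\setminus\mathcal{O}$ be a punctured or exterior domain with $\mathbb{R}^N\setminus B_e(0)\subset\Omega$. Assume that $$h_1(x,u,v)=|x|^{\beta_1}(\ln|x|)^{\tau_1}u^{p_1}v^{q_1},\qquad h_2(x,u,v)=|x|^{\beta_2}(\ln|x|)^{\tau_2}u^{p_2}v^{q_2},\qquad\forall\,x\in\mathbb{R}^N\setminus B_e(0),$$ where $p_1,q_2\ge1$, $p_2,q_1\ge0$, $\beta_1,\beta_2>-2$ and $\tau_1,\tau_2\in\mathbb{R}$. Write $p_\beta^*=\frac{N+\beta}{N-2}$. Then the system $$-\Delta u=h_1(x,u,v)\ \text{ in }\Omega,\qquad-\Delta v=h_2(x,u,v)\ \text{ in }\Omega,\qquad u,v\ge0\ \text{ on }\partial\Omega$$ has no positive supersolution if one of the following conditions holds: (i) $p_1+q_1<p_{\beta_1}^*$, $\tau_1,\tau_2\in\mathbb{R}$; (ii) $p_2+q_2<p_{\beta_2}^*$, $\tau_1,\tau_2\in\mathbb{R}$; (iii) $p_1+q_1=p_{\beta_1}^*$, $p_2+q_2=p_{\beta_2}^*$, $p_1>1$, $\tau_1>-1$, $\tau_2\in\mathbb{R}$; (iv) $p_1+q_1=p_{\beta_1}^*$, $p_2+q_2=p_{\beta_2}^*$, $q_2>1$, $\tau_2>-1$, $\tau_1\in\mathbb{R}$; (v) $p_1+q_1=p_{\beta_1}^*$, $p_2+q_2=p_{\beta_2}^*$, $\tau_1>-1$, $\tau_2>-1$.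
   Context: $B_r(0)$ is the ball of radius $r$ centered at the origin ($e$ is Euler's number). A punctured or exterior domain is a set $\Omega=\mathbb{R}^N\setminus\mathcal{O}$ where $\mathcal{O}$ is a bounded, closed, smooth subset of $\mathbb{R}^N$; typical examples are $\mathbb{R}^N\setminus\{0\}$ and $\mathbb{R}^N\setminus\overline{B}_R(0)$. The functions $h_1,h_2$ are real-valued functions on $\Omega\times[0,+\infty)\times[0,+\infty)$. A pair $(u,v)\in C^2(\Omega)\times C^2(\Omega)$ is a positive supersolution of the system if $u(x)>0$, $v(x)>0$, $-\Delta u(x)\ge h_1(x,u(x),v(x))$ and $-\Delta v(x)\ge h_2(x,u(x),v(x))$ for all $x\in\Omega$. *)

(* Defs.v *)
From mathcomp Require Import all_boot all_order all_algebra.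
From mathcomp Require Import all_classical all_reals all_analysis.
Import Order.TTheory GRing.Theory Num.Theory.
Import numFieldNormedType.Exports.

Set Implicit Arguments.
Unset Strict Implicit.
Unset Printing Implicit Defensive.

Local Open Scope classical_set_scope.
Local Open Scope ring_scope.

(* The library norm on 'rV[R]_N is the sup norm. It induces the right topology
   and the right bounded sets, but |x| in the statement is Euclidean. *)
Definition enorm (R : realType) (N : nat) (x : 'rV[R]_N) : R :=
  Num.sqrt (\sum_(i < N) x 0 i ^+ 2).

Definition eball (R : realType) (N : nat) (r : R) : set 'rV[R]_N :=
  [set x | enorm x < r].

Definition partial (R : realType) (N : nat) (i : 'I_N) (f : 'rV[R]_N -> R) :
  'rV[R]_N -> R := 'D_(delta_mx 0 i) f.

Definition laplacian (R : realType) (N : nat) (f : 'rV[R]_N -> R)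
  (x : 'rV[R]_N) : R := \sum_(i < N) partial i (partial i f) x.

(* f is of class C^k on U. Functions are total; only meaningful for U open, and
   then the values of f outside U play no role. *)
Fixpoint is_Ck (R : realType) (N : nat) (k : nat) (U : set 'rV[R]_N)
    (f : 'rV[R]_N -> R) : Prop :=
  (forall x, U x -> {for x, continuous f}) /\
  (if k is k'.+1 then
     forall i : 'I_N,
       (forall x, U x -> derivable f x (delta_mx 0 i)) /\
       is_Ck k' U (partial i f)
   else True).

Definition smooth_map (R : realType) (N : nat) (U : set 'rV[R]_N)
    (phi : 'rV[R]_N -> 'rV[R]_N) : Prop :=
  forall (i : 'I_N) (k : nat), is_Ck k U (fun x => phi x 0 i).

Definition smooth_chart (R : realType) (N : nat) (U : set 'rV[R]_N)
    (phi : 'rV[R]_N -> 'rV[R]_N) : Prop :=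
  exists (V : set 'rV[R]_N) (psi : 'rV[R]_N -> 'rV[R]_N),
    [/\ open U /\ open V,
        (forall x, U x -> V (phi x) /\ psi (phi x) = x),
        (forall y, V y -> U (psi y) /\ phi (psi y) = y),
        smooth_map U phi & smooth_map V psi].

Definition slice (R : realType) (N k : nat) : set 'rV[R]_N :=
  [set z | forall i : 'I_N, (k <= i)%N -> z 0 i = 0].

Definition half_slice (R : realType) (N k : nat) (j : 'I_N) : set 'rV[R]_N :=
  [set z | slice k z /\ 0 <= z 0 j].

(* Smooth subset of R^N: an embedded submanifold with (possibly empty)
   boundary, through the local slice condition. The dimension k may depend on
   the point, so that both a point (k = 0) and the closure of a smooth bounded
   open set (k = N) are smooth. *)
Definition smooth_set (R : realType) (N : nat) (O : set 'rV[R]_N) : Prop :=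
  forall x, O x ->
    exists (U : set 'rV[R]_N) (phi : 'rV[R]_N -> 'rV[R]_N) (k : nat),
      [/\ U x, smooth_chart U phi, (k <= N)%N &
          (forall y, U y -> (O y <-> slice k (phi y))) \/
          (exists2 j : 'I_N, (j < k)%N &
             forall y, U y -> (O y <-> half_slice k j (phi y)))].

Definition exterior_domain (R : realType) (N : nat) (Omega : set 'rV[R]_N) :
    Prop :=
  exists O : set 'rV[R]_N,
    [/\ bounded_set O, closed O, smooth_set O & Omega = ~` O].

Definition positive_supersolution (R : realType) (N : nat)
    (Omega : set 'rV[R]_N) (h1 h2 : 'rV[R]_N -> R -> R -> R)
    (u v : 'rV[R]_N -> R) : Prop :=
  [/\ is_Ck 2 Omega u, is_Ck 2 Omega v &
      forall x, Omega x ->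
        [/\ 0 < u x, 0 < v x,
            h1 x (u x) (v x) <= - laplacian u x &
            h2 x (u x) (v x) <= - laplacian v x]].

Definition pstar (R : realType) (N : nat) (beta : R) : R :=
  (N%:R + beta) / (N%:R - 2).

(* Main.v *)
Require Import Defs.
From mathcomp Require Import all_boot all_order all_algebra.
From mathcomp Require Import all_classical all_reals all_analysis.
From mathcomp Require Import ring lra.
Import Order.TTheory GRing.Theory Num.Theory.
Import numFieldNormedType.Exports.

Set Implicit Arguments.
Unset Strict Implicit.
Unset Printing Implicit Defensive.

Local Open Scope classical_set_scope.
Local Open Scope ring_scope.

(** The proof plays two facts about a positive supersolution against each
other: superharmonic functions cannot decay too fast, and a positive solution
of [- Delta u >= M |x|^-2 u] near infinity cannot exist once [M] exceeds the
Hardy constant. All estimates take place on [|x| >= e].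

Everything is written in the variable [s = logsq x = ln |x|^2], so that
[|x| >= e] reads [2 <= s], and with [mu = N / 2 - 1], so that the fundamental
solution [|x|^(2-N)] is [e^(- mu s)]. For a function of [s] the Laplacian is
[4 e^(-s) (Phi'' + mu Phi')] (laplacian_radial).

Lower bounds. Since [u, v > 0], the sources are positive, and comparison with
the fundamental solution on large annuli gives [u, v >= c e^(- mu s)]
(lower_bound with exponent 0). Substituting bounds of the form
[u >= c e^(- mu s) s^a] and [v >= d e^(- mu s) s^b] into the first inequality
yields [- Delta u >= C e^(- (1 + mu) s + theta s) s^(tau1 + p1 a + q1 b)] with
[theta = mu (p* - p1 - q1)]. In the critical case [theta = 0], comparison with
[e^(- mu s) s^(a + tau1 + 1)] improves the power of [s] from [a] to at least
[a + tau1 + 1]. Because [tau1 > -1], iterating makes the power arbitrarily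
large (critical_log_gain).

Contradiction. Keeping one factor [u] apart, the same substitution gives
[- Delta u >= C e^((theta - 1) s) s^(tau1 + (p1 - 1) a + q1 b) u]. As
[e^(-s) = |x|^-2], this is a linear inequality with a potential that is
eventually larger than any multiple of [|x|^-2] as soon as [theta > 0], or
[theta = 0] and the power of [s] is positive (source_nonexistence).
A compactly supported bump touching [u] from below rules this out
(linear_nonexistence). In the subcritical cases [a = b = 0] is enough; in the
critical cases [a] or [b] or both are first made large. When both [tau1] and
[tau2] exceed -1 this suffices because [p1 + q1 = p* > 1] leaves [p1 > 1] or
[q1 > 0]. The conditions on the second equation follow by exchanging the two
components.

Both comparisons rest on the second derivative test along the coordinate axes
alone: the differential inequalities are strict, so an interior minimum of the
difference already contradicts that test. *)

(** * Second derivatives at a minimum *)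

(** Restriction to a line, based at any point of it: this turns statements on
directional derivatives into statements on functions of one real variable. *)
Lemma is_derive_lineP (R : realType) (V : normedModType R) (f : V -> R)
    (x v : V) (h df : R) :
  is_derive (h *: v + x) v f df <->
  is_derive h 1 (fun t : R => f (t *: v + x)) df.
Proof.
suff E : (fun t : R => t^-1 *: ((f \o shift (h *: v + x)) (t *: v)
            - f (h *: v + x)))
       = (fun t : R => t^-1 *: (((fun t : R => f (t *: v + x)) \o shift h)
            (t *: 1) - f (h *: v + x))).
  by split=> -[d1 d2]; split; move: d1 d2; rewrite /derivable /derive E.
apply/funext => t /=; congr (_ *: (f _ - _)).
by rewrite [t%:A]mulr1 scalerDl addrA.
Qed.

Lemma is_derive_compR (R : realType) (V : normedModType R) (g : R -> R)
    (f : V -> R) (x v : V) (dg df : R) :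
  is_derive (f x) 1 g dg -> is_derive x v f df ->
  is_derive x v (fun y => g (f y)) (dg * df).
Proof.
move=> Hg Hf.
have E : x = 0 *: v + x by rewrite scale0r add0r.
rewrite E in Hf; rewrite E.
apply: (is_derive_lineP (fun y => g (f y)) x v 0 (dg * df)).2.
apply: (@is_derive1_comp _ g (fun t : R => f (t *: v + x))).
  by rewrite -E.
exact: (is_derive_lineP f x v 0 df).1.
Qed.

(** If [G2 < 0], then [G1], which vanishes at the minimum [0], is negative just
to the right of [0], so by the mean value theorem [G] drops below [G 0]. *)
Lemma second_derivative_test (R : realType) (G G1 : R -> R) (G2 : R) :
  (\forall h \near (0 : R), is_derive h (1 : R) G (G1 h)) ->
  is_derive (0 : R) (1 : R) G1 G2 -> (\forall h \near (0 : R), G 0 <= G h) ->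
  0 <= G2.
Proof.
move=> dG dG1 Gmin; rewrite leNgt; apply/negP => G2_lt0.
have : \forall h \near (0 : R), is_derive h (1 : R) G (G1 h) /\ G 0 <= G h.
  by apply: filterS2 dG Gmin => h ? ?.
move=> /nbhs_ballP[e /= e0 He].
have inball t : t \in `](- e), e[ -> ball (0 : R) e t.
  by rewrite in_itv /= -ball_normE /= sub0r normrN => te; rewrite ltr_norml.
have G10 : G1 0 = 0.
  have H0 : 0 \in `](- e), e[ by rewrite in_itv /= e0 oppr_lt0 e0.
  have [D0 _] := He _ (inball _ H0).
  have D0' : is_derive (0 : R) 1 G 0.
    apply: (@derive1_at_min _ G (- e) e 0) => //.
    - by rewrite ge0_cp // ltW.
    - by move=> t /inball /He[[]].
    - by move=> t /inball /He[].
  by rewrite -(@derive_val _ _ _ _ _ _ _ D0) (@derive_val _ _ _ _ _ _ _ D0').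
have [cv lv] := dG1.
have : \forall h \near (0 : R)^',
    h^-1 *: ((G1 \o shift 0) (h *: (1 : R)) - G1 0) < 0.
  have cv' : h^-1 *: ((G1 \o shift 0) (h *: (1 : R)) - G1 0)
             @[h --> (0 : R)^'] --> G2 by rewrite -lv; exact: cv.
  exact: (cvgr_lt _ cv' _ G2_lt0).
rewrite near_withinE => /nbhs_ballP[d /= d0 Hd].
pose m := Num.min e d / 2.
have m0 : 0 < m by rewrite divr_gt0 // lt_min e0.
have me : m < e.
  by rewrite ltr_pdivrMr // gt_min; apply/orP;
  left; rewrite mulr_natr mulr2n ltrDl.
have md : m < d.
  by rewrite ltr_pdivrMr // gt_min; apply/orP;
  right; rewrite mulr_natr mulr2n ltrDl.
have inm t : 0 <= t <= m -> ball (0 : R) e t.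
  case/andP=> t0 tm; apply: inball; rewrite in_itv /= (le_lt_trans tm) // andbT.
  by apply: lt_le_trans t0; rewrite oppr_lt0.
have [||c cm E] := @MVT _ G G1 0 m m0.
- move=> t; rewrite in_itv /= => /andP[t0 tm].
  by have [] := He t (inm t _); rewrite ?(ltW t0) ?(ltW tm).
- apply: derivable_within_continuous => t; rewrite in_itv /= => tm.
  by have [[]] := He t (inm t tm).
move: cm; rewrite in_itv /= => /andP[c0 cm].
have : G1 c < 0.
  have : c^-1 *: ((G1 \o shift 0) (c *: (1 : R)) - G1 0) < 0.
    apply: Hd; last by rewrite /= gt_eqF.
    by rewrite -ball_normE /= sub0r normrN gtr0_norm // (lt_trans cm).
  rewrite /= addr0 [c%:A]mulr1 G10 subr0 => H.
  by rewrite -(pmulr_rlt0 _ (_ : 0 < c^-1)) ?invr_gt0.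
move=> Gc; have mm : 0 <= m <= m by rewrite lexx ltW.
have [_] := He m (inm m mm).
by rewrite leNgt -subr_lt0 E subr0 pmulr_llt0 // Gc.
Qed.

(** The pointwise regularity under which the Laplacian at [x] makes sense and
is additive: first partial derivatives near [x], since [partial i f] is itself
differentiated there, and second ones at [x]. *)
Definition twice_partial (R : realType) (N : nat) (f : 'rV[R]_N -> R)
    (x : 'rV[R]_N) :=
  forall i : 'I_N, (\forall y \near x, derivable f y (delta_mx 0 i)) /\
    derivable (partial i f) x (delta_mx 0 i).

Lemma laplacian_ge0_at_min (R : realType) (N : nat) (f : 'rV[R]_N -> R)
    (x : 'rV[R]_N) :
  twice_partial f x -> (\forall y \near x, f x <= f y) -> 0 <= laplacian f x.
Proof.
move=> df fmin; apply: sumr_ge0 => i _.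
have [df1 df2] := df i.
have Ex : 0 *: delta_mx 0 i + x = x by rewrite scale0r add0r.
have line_cvg :
    (fun h : R => h *: (delta_mx 0 i : 'rV[R]_N) + x) @ (0 : R) --> x.
  rewrite -[X in _ --> X]Ex; apply: cvgD; last exact: cvg_cst.
  by apply: cvgZr_tmp; exact: cvg_id.
apply: (@second_derivative_test _ (fun h : R => f (h *: delta_mx 0 i + x))
  (fun h : R => partial i f (h *: delta_mx 0 i + x))).
- have : \forall h \near (0 : R),
      derivable f (h *: delta_mx 0 i + x) (delta_mx 0 i).
    exact: line_cvg _ df1.
  apply: filterS => h dh.
  exact: ((is_derive_lineP f x _ h _).1 (derivableP dh)).
- rewrite -[in derivable _ x]Ex in df2.
  rewrite -[in partial i (partial i f) x]Ex.
  exact: ((is_derive_lineP (partial i f) x _ 0 _).1 (derivableP df2)).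
- by rewrite Ex; exact: line_cvg _ fmin.
Qed.

Lemma twice_partialB (R : realType) (N : nat) (k : R) (f g : 'rV[R]_N -> R)
    (x : 'rV[R]_N) : twice_partial f x -> twice_partial g x ->
  twice_partial (fun y => k * f y - g y) x /\
  laplacian (fun y => k * f y - g y) x = k * laplacian f x - laplacian g x.
Proof.
move=> df dg.
have D1 i y : derivable f y (delta_mx 0 i) -> derivable g y (delta_mx 0 i) ->
    is_derive y (delta_mx 0 i) (fun y => k * f y - g y)
      (k * partial i f y - partial i g y).
  move=> dfy dgy; have dkf := is_deriveZ k (derivableP dfy).
  exact: (is_deriveB dkf (derivableP dgy)).
have D2 i : is_derive x (delta_mx 0 i)
    (partial i (fun y => k * f y - g y))
    (k * partial i (partial i f) x - partial i (partial i g) x).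
  have [df1 df2] := df i; have [dg1 dg2] := dg i.
  apply: (near_eq_is_derive (f := fun y => k * partial i f y - partial i g y)).
    apply: filterS2 df1 dg1 => y dfy dgy.
    by have [_ <-] := D1 i y dfy dgy.
  have dkf := is_deriveZ k (derivableP df2).
  exact: (is_deriveB dkf (derivableP dg2)).
split.
  move=> i; have [df1 df2] := df i; have [dg1 dg2] := dg i; split.
    by apply: filterS2 df1 dg1 => y dfy dgy; have [] := D1 i y dfy dgy.
  by have [] := D2 i.
rewrite /laplacian mulr_sumr -sumrB; apply: eq_bigr => i _.
by have [_ E] := D2 i; exact: E.
Qed.

(** * The Laplacian of radial functions *)

Definition sqnorm (R : realType) (N : nat) (x : 'rV[R]_N) : R :=
  \sum_(i < N) x 0 i ^+ 2.

Definition logsq (R : realType) (N : nat) (x : 'rV[R]_N) : R := ln (sqnorm x).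

(** Since [ln] is 0 on nonpositive numbers, positivity of [logsq x] already
keeps [x] away from the origin. *)
Lemma sqnorm_gt0 (R : realType) (N : nat) (x : 'rV[R]_N) :
  0 < logsq x -> 0 < sqnorm x.
Proof.
rewrite ltNge => H; rewrite ltNge; apply: contra H => /ln0.
by rewrite /logsq => ->.
Qed.

Lemma expR_logsq (R : realType) (N : nat) (x : 'rV[R]_N) :
  0 < logsq x -> expR (logsq x) = sqnorm x.
Proof. by move=> /sqnorm_gt0 x0; rewrite /logsq lnK. Qed.

Lemma sqnorm_continuous (R : realType) (N : nat) : continuous (@sqnorm R N).
Proof.
apply: continuous_big => [|i _ x]; first exact: add_continuous.
apply: (continuous_comp (f := fun y : 'rV[R]_N => y 0 i)
  (g := fun t : R => t ^+ 2)).
  exact: coord_continuous.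
exact: exprn_continuous.
Qed.

Lemma logsq_continuous (R : realType) (N : nat) (x : 'rV[R]_N) :
  0 < logsq x -> {for x, continuous (@logsq R N)}.
Proof.
move=> /sqnorm_gt0 x0; apply: continuous_comp; first exact: sqnorm_continuous.
exact: continuous_ln.
Qed.

Lemma is_derive_coord (R : realType) (N : nat) (x : 'rV[R]_N) (i j : 'I_N) :
  is_derive x (delta_mx 0 i) (fun y : 'rV[R]_N => y 0 j) (j == i)%:R.
Proof.
have Ex : 0 *: delta_mx 0 i + x = x by rewrite scale0r add0r.
rewrite -[x in is_derive x]Ex.
apply: (is_derive_lineP (fun y : 'rV[R]_N => y 0 j) x _ 0 _).2.
rewrite (_ : (fun t : R => _) =
  (fun t => t * (j == i)%:R + x 0 j)); last first.
  by apply/funext => t; rewrite !mxE eqxx.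
apply: is_derive_eq.
by rewrite /GRing.scale /= mulr0 mulr1 add0r addr0.
Qed.

Lemma is_derive_sqnorm (R : realType) (N : nat) (x : 'rV[R]_N) (i : 'I_N) :
  is_derive x (delta_mx 0 i) (@sqnorm R N) (2 * x 0 i).
Proof.
rewrite (_ : @sqnorm R N =
  \sum_(j < N) (fun y : 'rV[R]_N => y 0 j) ^+ 2); last first.
  by apply/funext => y; rewrite fct_sumE.
have D j := is_deriveX 2 (is_derive_coord x i j).
apply: is_derive_eq (is_derive_sum D) _.
rewrite (bigD1 i) //= big1 => [|j /negPf jNi]; last first.
  by rewrite jNi mulr0n scaler0.
by rewrite eqxx addr0 expr1 /GRing.scale /= mulr1 mulr_natl.
Qed.

Lemma is_derive_logsq (R : realType) (N : nat) (x : 'rV[R]_N) (i : 'I_N) :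
  0 < logsq x ->
  is_derive x (delta_mx 0 i) (@logsq R N) ((sqnorm x)^-1 * (2 * x 0 i)).
Proof.
move=> /sqnorm_gt0 x0.
exact: (is_derive_compR (is_derive1_ln x0) (is_derive_sqnorm x i)).
Qed.

(** In the variable [s = ln |x|^2] the radial Laplacian has constant
coefficients, up to the factor [4 / |x|^2 = 4 e^(-s)]. *)
Lemma laplacian_radial (R : realType) (N : nat) (Phi Phi1 Phi2 : R -> R)
    (x : 'rV[R]_N) :
  (forall s : R, 0 < s -> is_derive s (1 : R) Phi (Phi1 s)) ->
  (forall s : R, 0 < s -> is_derive s (1 : R) Phi1 (Phi2 s)) ->
  0 < logsq x ->
  twice_partial (fun y => Phi (logsq y)) x /\
  laplacian (fun y => Phi (logsq y)) x =
    4 * expR (- logsq x) *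
      (Phi2 (logsq x) + (N%:R / 2 - 1) * Phi1 (logsq x)).
Proof.
move=> dPhi dPhi1 x1; have x0 := sqnorm_gt0 x1.
have near_pos : \forall y \near x, 0 < logsq y.
  exact: (cvgr_gt _ (logsq_continuous x1)).
have D1 (i : 'I_N) (y : 'rV[R]_N) : 0 < logsq y ->
    is_derive y (delta_mx 0 i) (fun y => Phi (logsq y))
      (Phi1 (logsq y) * ((sqnorm y)^-1 * (2 * y 0 i))).
  by move=> y1; apply: is_derive_compR (is_derive_logsq i y1); exact: dPhi.
have D2 i : is_derive x (delta_mx 0 i) (partial i (fun y => Phi (logsq y)))
    (4 * Phi2 (logsq x) * (sqnorm x)^- 2 * x 0 i ^+ 2 +
     Phi1 (logsq x) * (2 * (sqnorm x)^-1 - 4 * (sqnorm x)^- 2 * x 0 i ^+ 2)).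
  apply: (near_eq_is_derive
    (f := fun y => Phi1 (logsq y) * ((sqnorm y)^-1 * (2 * y 0 i)))).
    by apply: filterS near_pos => y y1; have [_ <-] := D1 i y y1.
  have dP := is_derive_compR (dPhi1 _ x1) (is_derive_logsq i x1).
  have dV := is_derive_compR
    (is_deriveV (lt0r_neq0 x0) (is_derive_id (sqnorm x) (1 : R)))
    (is_derive_sqnorm x i).
  have dC := is_deriveZ 2 (is_derive_coord x i i).
  apply: is_derive_eq (is_deriveM dP (is_deriveM dV dC)) _.
  have E (a b r y : R) : r != 0 ->
      a * (r^-1 * (2 * 1) + 2 * y * (- r ^- 2 * 1 * (2 * y))) +
      r^-1 * (2 * y) * (b * (r^-1 * (2 * y))) =
      4 * b * r ^- 2 * y ^+ 2 + a * (2 * r^-1 - 4 * r ^- 2 * y ^+ 2).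
    by move=> r0; field.
  by rewrite eqxx; exact: E (lt0r_neq0 x0).
split.
  move=> i; split; last by have [] := D2 i.
  by apply: filterS near_pos => y y1; have [] := D1 i y y1.
rewrite /laplacian (eq_bigr (fun i : 'I_N =>
    (4 * Phi2 (logsq x) - 4 * Phi1 (logsq x)) * (sqnorm x)^- 2 * x 0 i ^+ 2 +
     Phi1 (logsq x) * 2 * (sqnorm x)^-1)); last first.
  by move=> i _; have [_ E] := D2 i; rewrite [LHS]E; ring.
rewrite big_split /= -mulr_sumr sumr_const card_ord -/(sqnorm x).
rewrite expRN expR_logsq // -mulr_natl.
by field; rewrite lt0r_neq0.
Qed.

(** * Minima over annuli *)

Lemma annulus_compact (R : realType) (N : nat) (s1 s2 : R) : 0 < s1 ->
  compact [set x : 'rV[R]_N | s1 <= logsq x <= s2].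
Proof.
move=> s1_gt0.
rewrite (_ : [set x | _] =
    (@sqnorm R N) @^-1` [set` `[expR s1, expR s2]]); last first.
  apply/seteqP; split=> x /=; rewrite in_itv /= => /andP[x1 x2].
    by rewrite -expR_logsq ?(lt_le_trans s1_gt0) // !ler_expR x1.
  have x0 := lt_le_trans (expR_gt0 s1) x1.
  rewrite -(ler_expR s1 (logsq x)) -(ler_expR (logsq x) s2) /logsq.
  by rewrite lnK // x1.
set A := _ @^-1` _.
have clA : closed A.
  apply: preimage_closed; last exact: interval_closed.
  by move=> x _; exact: sqnorm_continuous.
pose M := 1 + expR s2.
have M1 : 1 <= M by rewrite lerDl expR_ge0.
have cM : compact [set x : 'rV[R]_N | forall i, [set` `[- M, M]] (x ord0 i)].
  by apply: (@rV_compact _ _ (fun=> [set` `[- M, M]])) => _;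
    exact: segment_compact.
apply: subclosed_compact clA cM _ => x.
rewrite /A /= in_itv /= => /andP[_ x2] i.
rewrite in_itv /= -ler_norml leNgt; apply/negP => Mx.
have : `|x ord0 i| ^+ 2 <= expR s2.
  rewrite real_normK ?num_real //; apply: le_trans x2.
  rewrite /sqnorm (bigD1 i) //= lerDl; apply: sumr_ge0 => j _; exact: sqr_ge0.
apply/negP; rewrite -ltNge.
apply: (@lt_le_trans _ _ M); first by rewrite /M ltrDr.
by rewrite expr2 (le_trans (ltW Mx)) // ler_peMl // (le_trans M1) // ltW.
Qed.

Lemma annulus_min (R : realType) (N : nat) (s1 s2 : R) (g : 'rV[R]_N -> R)
    (x : 'rV[R]_N) :
  0 < s1 -> (forall x, s1 <= logsq x <= s2 -> {for x, continuous g}) ->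
  s1 <= logsq x <= s2 ->
  exists2 c : 'rV[R]_N, s1 <= logsq c <= s2 &
    forall y, s1 <= logsq y <= s2 -> g c <= g y.
Proof.
move=> s1_gt0 cg xA.
have [|||c cA cmin] := @EVT_min_rV R N g [set x | s1 <= logsq x <= s2].
- by exists x.
- exact: annulus_compact.
- by apply: continuous_in_subspaceT => y /set_mem; exact: cg.
by exists c => [|y yA]; [exact: set_mem cA|apply: cmin; rewrite inE].
Qed.

Lemma annulus_nbhs (R : realType) (N : nat) (s1 s2 : R) (x : 'rV[R]_N) :
  0 < s1 -> s1 < logsq x < s2 -> \forall y \near x, s1 <= logsq y <= s2.
Proof.
move=> s1_gt0 /andP[x1 x2].
have cx := logsq_continuous (lt_trans s1_gt0 x1).
have n1 : \forall y \near x, s1 < logsq y by exact: (cvgr_gt _ cx).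
have n2 : \forall y \near x, logsq y < s2 by exact: (cvgr_lt _ cx).
by apply: filterS2 n1 n2 => y /ltW -> /ltW ->.
Qed.

(** Maximum principle with a strict differential inequality, required only
where [g < 0]: a negative minimum would be interior, where the Laplacian cannot
be negative. *)
Lemma annulus_min_principle (R : realType) (N : nat) (s1 s2 : R)
    (g : 'rV[R]_N -> R) : 0 < s1 ->
  (forall x, s1 <= logsq x <= s2 -> {for x, continuous g}) ->
  (forall x, s1 < logsq x < s2 -> twice_partial g x) ->
  (forall x, s1 < logsq x < s2 -> g x < 0 -> laplacian g x < 0) ->
  (forall x, logsq x = s1 \/ logsq x = s2 -> 0 <= g x) ->
  forall x, s1 <= logsq x <= s2 -> 0 <= g x.
Proof.
move=> s1_gt0 cg tg Lg bg x xA.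
have [c cA cmin] := annulus_min s1_gt0 cg xA.
apply: le_trans (cmin _ xA); rewrite leNgt; apply/negP => gc.
have cI : s1 < logsq c < s2.
  rewrite !lt_neqAle (andP cA).1 (andP cA).2 !andbT.
  by apply/andP; split; apply: contraTneq gc => E;
    rewrite -leNgt bg //; [left|right].
have := laplacian_ge0_at_min (tg _ cI).
rewrite leNgt Lg // => H; have // : false; apply: H.
by apply: filterS (annulus_nbhs s1_gt0 cI) => y; exact: cmin.
Qed.

Lemma exists_logsq (R : realType) (N : nat) (s : R) :
  (0 < N)%N -> exists x : 'rV[R]_N, logsq x = s.
Proof.
move=> N0; exists (\row_j (if j == Ordinal N0 then expR (s / 2) else 0)).
rewrite /logsq /sqnorm (bigD1 (Ordinal N0)) //= big1 => [|i /negPf iN].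
  by rewrite mxE eqxx addr0 -expRM_natl mulrC divfK // expRK.
by rewrite mxE iN expr0n.
Qed.

(** * Exponentials against powers *)

Lemma expR_pow_decay (R : realType) (mu a eta : R) : 0 < mu -> 0 < eta ->
  exists S0 : R, forall s, S0 <= s -> expR (- (mu * s)) * s `^ a <= eta.
Proof.
move=> mu0 eta0; pose n := Num.bound `|a|.
have an : a <= n%:R.
  exact: le_trans (ler_norm a) (ltW (archi_boundP (normr_ge0 a))).
pose K := n.+1`!%:R / mu ^+ n.+1 / eta.
have K0 : 0 < K.
  by rewrite !divr_gt0 // ?exprn_gt0 // ltr0n fact_gt0.
exists (1 + K) => s Ks.
have s1 : 1 <= s by apply: le_trans Ks; rewrite lerDl ltW.
have s0 : 0 < s by apply: lt_le_trans s1.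
have sn : s `^ a <= s ^+ n by rewrite -powR_mulrn ?(ltW s0) // ler_powR.
(* one more power than [s ^+ n] leaves a factor [s] to spare *)
have es : (mu * s) ^+ n.+1 / n.+1`!%:R <= expR (mu * s).
  apply: le_trans (expR_ge1Dxn n _); last by rewrite mulr_ge0 // ltW.
  by rewrite lerDr.
rewrite expRN mulrC ler_pdivrMr ?expR_gt0 //; apply: le_trans sn _.
apply: (@le_trans _ _ (eta * ((mu * s) ^+ n.+1 / n.+1`!%:R))); last first.
  by rewrite ler_wpM2l // ltW.
have -> : eta * ((mu * s) ^+ n.+1 / n.+1`!%:R) = s ^+ n * (s / K).
  rewrite /K exprMn [s ^+ n.+1]exprSr; field.
  by rewrite !lt0r_neq0 ?exprn_gt0 // ltr0n fact_gt0.
rewrite ler_peMr ?exprn_ge0 ?(ltW s0) // ler_pdivlMr // mul1r.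
by apply: le_trans Ks; rewrite lerDr.
Qed.

Lemma expR_pow_growth (R : realType) (theta kappa M : R) :
  0 < theta \/ theta = 0 /\ 0 < kappa ->
  exists S : R, forall s, S <= s -> 0 < s ->
    M <= expR (theta * s) * s `^ kappa.
Proof.
pose M' := 1 + `|M|.
have M'0 : 0 < M' by rewrite ltr_pwDl.
have MM : M <= M' by rewrite (le_trans (ler_norm M)) // lerDr.
case=> [theta0|[-> kappa0]].
  have M'V : 0 < M'^-1 by rewrite invr_gt0.
  have [S HS] := expR_pow_decay (- kappa) theta0 M'V.
  exists S => s Ss s0; apply: le_trans MM _.
  move: (HS s Ss); rewrite expRN powRN -invfM lef_pV2 // posrE.
  by rewrite mulr_gt0 ?expR_gt0 ?powR_gt0.
exists (M' `^ kappa^-1) => s Ms s0; apply: le_trans MM _.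
have ME : (M' `^ kappa^-1) `^ kappa = M'.
  by rewrite -powRrM mulVf ?lt0r_neq0 // powRr1 // ltW.
rewrite mul0r expR0 mul1r -ME.
by apply: ge0_ler_powR => //; rewrite ?nnegrE ?powR_ge0 // ltW.
Qed.

(** * Lower bounds by comparison *)

Lemma continuous_scaleB (R : realType) (T : topologicalType) (k : R)
    (f g : T -> R) (x : T) :
  {for x, continuous f} -> {for x, continuous g} ->
  {for x, continuous (fun y => k * f y - g y)}.
Proof.
move=> cf cg; apply: cvgB; last exact: cg.
by apply: cvgM; [exact: cvg_cst|exact: cf].
Qed.

(** Half of [N - 2], because [logsq] is twice the logarithm of [|x|]:
[|x|^(2-N)] is the exponential of [- decay_rate * logsq x]. *)
Definition decay_rate (R : realType) (N : nat) : R := N%:R / 2 - 1.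

Lemma is_derive_expR_pow (R : realType) (mu a s : R) : 0 < s ->
  is_derive s (1 : R) (fun t => expR (- (mu * t)) * t `^ a)
    (a * (expR (- (mu * s)) * s `^ (a - 1)) -
     mu * (expR (- (mu * s)) * s `^ a)).
Proof.
move=> s0.
have dE : is_derive s (1 : R) (fun t => expR (- (mu * t)))
    (expR (- (mu * s)) * (- mu)).
  apply: is_derive_compR.
  have dL := is_deriveN (is_deriveZ mu (is_derive_id s (1 : R))).
  by apply: is_derive_eq dL _; rewrite /GRing.scale /= mulr1.
apply: is_derive_eq (is_deriveM dE (is_derive1_powR a s0)) _.
by rewrite /GRing.scale /=; ring.
Qed.

(** The term without derivatives of [s^a] cancels because [e^(- mu s)] is
harmonic. The constant [delta] makes this comparison function nonpositive on a
large sphere. *)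
Lemma laplacian_expR_pow (R : realType) (N : nat) (a eps delta : R)
    (x : 'rV[R]_N) (mu := decay_rate R N)
    (W := fun y : 'rV[R]_N =>
       eps * (expR (- (mu * logsq y)) * logsq y `^ a) - delta) :
  0 < logsq x ->
  [/\ {for x, continuous W}, twice_partial W x &
      laplacian W x = 4 * expR (- logsq x) * (eps * expR (- (mu * logsq x)) *
        (a * (a - 1) * logsq x `^ (a - 1 - 1) -
         mu * a * logsq x `^ (a - 1)))].
Proof.
move=> x1.
pose P (b s : R) := expR (- (mu * s)) * s `^ b.
pose Phi s := eps * P a s - delta.
pose Phi1 s := eps * (a * P (a - 1) s - mu * P a s).
pose Phi2 s := eps * (a * ((a - 1) * P (a - 1 - 1) s - mu * P (a - 1) s) -
  mu * (a * P (a - 1) s - mu * P a s)).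
have dPhi (s : R) : 0 < s -> is_derive s (1 : R) Phi (Phi1 s).
  move=> s0; have d1 := is_derive_expR_pow mu a s0.
  apply: is_derive_eq
    (is_deriveB (is_deriveZ eps d1) (is_derive_cst delta s (1 : R))) _.
  by rewrite subr0.
have dPhi1 (s : R) : 0 < s -> is_derive s (1 : R) Phi1 (Phi2 s).
  move=> s0; have d1 := is_derive_expR_pow mu a s0.
  have d2 := is_derive_expR_pow mu (a - 1) s0.
  exact: (is_deriveZ eps (is_deriveB (is_deriveZ a d2) (is_deriveZ mu d1))).
have [tW LW] := laplacian_radial dPhi dPhi1 x1.
split => //.
  apply: (@continuous_comp _ _ _ (@logsq R N) Phi).
    exact: logsq_continuous.
  apply: differentiable_continuous; apply/derivable1_diffP.
  by have [] := dPhi _ x1.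
rewrite [LHS]LW -/(decay_rate R N) -/mu /Phi1 /Phi2 /P; ring.
Qed.

(** The bound [2 <= logsq x] describes [|x| >= e], where the system is given
by its explicit form. *)
Definition positive_outside (R : realType) (N : nat) (u : 'rV[R]_N -> R) :=
  forall x, 2 <= logsq x ->
    [/\ 0 < u x, {for x, continuous u} & twice_partial u x].

(** Comparison of [u] with [eps e^(- mu s) s^a - delta] on the annulus
[2 <= s <= S]. The number [eps] is taken small enough for the inner sphere and
for the differential inequality; [S] depends on [delta] and makes the
comparison function nonpositive on the outer sphere; finally [delta] tends
to 0. The factor [a] in the hypothesis lets [a = 0] be the case of a strictly
superharmonic [u]. *)
Lemma lower_bound (R : realType) (N : nat) (u : 'rV[R]_N -> R) (a c : R)
    (mu := decay_rate R N) :
  0 < mu -> positive_outside u -> 0 <= a -> 0 < c ->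
  (forall x, 2 <= logsq x ->
    c * a * expR (- ((1 + mu) * logsq x)) * logsq x `^ (a - 1)
      < - laplacian u x) ->
  exists2 c' : R, 0 < c' & forall x, 2 <= logsq x ->
    c' * (expR (- (mu * logsq x)) * logsq x `^ a) <= u x.
Proof.
move=> mu0 upos a0 c0 Lu.
have two_gt0 : 0 < 2 :> R by [].
have N0 : (0 < N)%N.
  by rewrite lt0n; apply: contraTneq mu0 => N0; rewrite /mu /decay_rate N0; lra.
pose P (s : R) := expR (- (mu * s)) * s `^ a.
have P0 (s : R) : 0 < s -> 0 < P s.
  by move=> s0; rewrite mulr_gt0 ?expR_gt0 ?powR_gt0.
(* minimum of u on the sphere |x| = e *)
have [x0 x0E] := exists_logsq (2 : R) N0.
have cu0 x : 2 <= logsq x <= 2 -> {for x, continuous u}.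
  by move=> /andP[x2 _]; have [] := upos x x2.
have x0A : 2 <= logsq x0 <= 2 by rewrite x0E lexx.
have [z zA zmin] := annulus_min two_gt0 cu0 x0A.
have [uz _ _] := upos z (andP zA).1.
pose eps := Num.min (c / (4 * (1 + mu))) (u z / P 2).
have d0 : 0 < 4 * (1 + mu) by lra.
have eps0 : 0 < eps by rewrite lt_min !divr_gt0 ?P0.
have eps1 : 4 * eps * (1 + mu) <= c.
  by rewrite mulrAC mulrC -ler_pdivlMr // ge_min lexx.
have eps2 : eps * P 2 <= u z by rewrite -ler_pdivlMr ?P0 // ge_min lexx orbT.
exists eps => // x xE; rewrite -/(P _).
apply/ler_addgt0Pr => delta delta0.
have [S0 HS0] := expR_pow_decay a mu0 (divr_gt0 delta0 eps0).
pose S := Num.max (logsq x) S0.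
have PS : eps * P S <= delta.
  by rewrite mulrC -ler_pdivlMr //; apply: HS0; rewrite le_max lexx orbT.
have SE : 2 <= S by rewrite le_max xE.
pose g y := 1 * u y - (eps * P (logsq y) - delta).
suff : 0 <= g x by rewrite /g mul1r opprB addrA subr_ge0.
have W (y : 'rV[R]_N) (y2 : 2 <= logsq y) :=
  laplacian_expR_pow a eps delta (lt_le_trans two_gt0 y2).
apply: (@annulus_min_principle R N 2 S) => //.
- move=> y /andP[y2 _]; have [_ cu _] := upos y y2; have [cW _ _] := W y y2.
  exact: (continuous_scaleB (k := 1) cu cW).
- move=> y /andP[/ltW y2 _]; have [_ _ tu] := upos y y2.
  have [_ tW _] := W y y2.
  by have [] := twice_partialB 1 tu tW.
- move=> y /andP[/ltW y2 _] _; have [_ _ tu] := upos y y2.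
  have [_ tW LW] := W y y2; have [_ ->] := twice_partialB 1 tu tW.
  have y0 : 0 < logsq y := lt_le_trans two_gt0 y2.
  rewrite mul1r LW subr_lt0 -ltrN2; apply: le_lt_trans (Lu y y2).
  have LV : logsq y `^ (a - 1 - 1) = logsq y `^ (a - 1) / logsq y.
    by rewrite powRB ?powRr1 ?ltW // lt0r_neq0 ?implybT.
  have EE : expR (- ((1 + mu) * logsq y)) =
      expR (- logsq y) * expR (- (mu * logsq y)).
    by rewrite -expRD; congr expR; ring.
  rewrite LV EE; set Q := _ `^ (a - 1); set E := expR (- logsq y).
  set F := expR (- (mu * _)).
  have Q0 : 0 <= Q by exact: powR_ge0.
  (* Up to nonnegative factors, the Laplacian of the comparison function is
     [- (mu + (1 - a) / s)], which is at least [- (1 + mu)]. *)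
  have k1 : (1 - a) / logsq y <= 1.
    rewrite ler_pdivrMr // mul1r (le_trans _ y2) //.
    by rewrite lerBlDr (le_trans (_ : 1 <= 2)) // ?lerDl // ler1n.
  have k2 : 4 * eps * (mu + (1 - a) / logsq y) <= c.
    have k3 : mu + (1 - a) / logsq y <= 1 + mu by rewrite addrC lerD2r.
    have e4 : 0 <= 4 * eps by rewrite mulr_ge0 // ltW.
    exact: le_trans (ler_wpM2l e4 k3) eps1.
  have -> : - (4 * E * (eps * F * (a * (a - 1) * (Q / logsq y) - mu * a * Q))) =
      (4 * eps * (mu + (1 - a) / logsq y)) * (a * (E * F) * Q) by ring.
  rewrite -(mulrA c) -(mulrA c) ler_wpM2r // !mulr_ge0 ?expR_ge0 //.
- move=> y; rewrite /g mul1r => -[] yE; rewrite subr_ge0 yE.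
    apply: (@le_trans _ _ (eps * P 2)); first by rewrite lerBlDr lerDl ltW.
    by apply: le_trans eps2 _; apply: zmin; rewrite yE lexx.
  apply: (@le_trans _ _ 0); first by rewrite subr_le0.
  have y2 : 2 <= logsq y by rewrite yE.
  by have [/ltW] := upos y y2.
- by rewrite xE le_max lexx.
Qed.

(** * Nonexistence for the linear inequality *)

(** The bump [g^2], with [g = (s - s1) (s1 + 1 - s)]. Its second derivative is
simplified by [g'^2 = 1 - 4 g] and [g'' = -2]. *)
Lemma is_derive_bump (R : realType) (s1 s : R)
    (g := fun t : R => (t - s1) * (s1 + 1 - t)) :
  is_derive s (1 : R) (fun t => g t ^+ 2) (2 * g s * (1 - 2 * (s - s1))) /\
  is_derive s (1 : R) (fun t => 2 * g t * (1 - 2 * (t - s1)))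
    (2 * (1 - 2 * (s - s1)) ^+ 2 - 4 * g s).
Proof.
have dg : is_derive s (1 : R) g (1 - 2 * (s - s1)).
  by rewrite /g; apply: is_derive_eq; rewrite /GRing.scale /=; ring.
have dg1 : is_derive s (1 : R) (fun t => 1 - 2 * (t - s1)) (- 2).
  by apply: is_derive_eq; rewrite /GRing.scale /=; ring.
split.
  apply: is_derive_eq (is_deriveX 2 dg) _.
  by rewrite /GRing.scale /=; ring.
apply: is_derive_eq (is_deriveM (is_deriveZ 2 dg) dg1) _.
have E (y z : R) : 2 * y * - 2 + z * (2 * z) = 2 * z ^+ 2 - 4 * y by ring.
exact: E.
Qed.

(** Let [w = g^2] be the bump of the annulus [s1 <= s <= s1 + 1], and [k] the
largest value of [w / u] there. Then [k u - w] is minimal, equal to 0, at an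
interior point [c], so its Laplacian is nonnegative at [c]. But with
[M = 4 (mu^2 + 17)] it is at most
[- 4 e^(-s) ((mu g + g')^2 + (1 - 4 g)^2 + g^2) < 0]. Of the constant 17, the
part 16 completes the square and the rest gives strictness. *)
Lemma linear_nonexistence (R : realType) (N : nat) (u : 'rV[R]_N -> R) :
  (0 < N)%N -> positive_outside u ->
  (forall M : R, exists S : R, forall x, S <= logsq x -> 2 <= logsq x ->
     M * expR (- logsq x) * u x <= - laplacian u x) -> False.
Proof.
move=> N0 upos uM.
pose mu := decay_rate R N.
have [S HS] := uM (4 * (mu ^+ 2 + 17)).
pose s1 := Num.max S 2; pose g (t : R) := (t - s1) * (s1 + 1 - t).
pose w (x : 'rV[R]_N) := g (logsq x) ^+ 2.
have s1S : S <= s1 by rewrite le_max lexx.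
have s12 : 2 <= s1 by rewrite le_max lexx orbT.
have s1_gt0 : 0 < s1 by apply: lt_le_trans s12.
have D1 (s : R) := (is_derive_bump s1 s).1.
have D2 (s : R) := (is_derive_bump s1 s).2.
have cw x : 0 < logsq x -> {for x, continuous w}.
  move=> x0; apply: (@continuous_comp _ _ _ (@logsq R N) (fun t => g t ^+ 2)).
    exact: logsq_continuous.
  apply: differentiable_continuous; apply/derivable1_diffP.
  by have [] := D1 (logsq x).
have Lw (x : 'rV[R]_N) :=
  laplacian_radial (fun s _ => D1 s) (fun s _ => D2 s) (x := x).
have pos (x : 'rV[R]_N) : s1 <= logsq x <= s1 + 1 -> 0 < u x.
  by move=> /andP[x1 _]; have [] := upos x (le_trans s12 x1).
have cr x : s1 <= logsq x <= s1 + 1 ->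
    {for x, continuous (fun y => - (w y / u y))}.
  move=> xA; have x1 := (andP xA).1.
  have [ux cu _] := upos x (le_trans s12 x1).
  have cwx := cw x (lt_le_trans s1_gt0 x1).
  exact: continuousN (continuousM cwx (continuousV (lt0r_neq0 ux) cu)).
have [x0 x0E] := exists_logsq (s1 + 2^-1) N0.
have x0A : s1 <= logsq x0 <= s1 + 1 by rewrite x0E; lra.
have [c cA cmax] := annulus_min s1_gt0 cr x0A.
have uc := pos _ cA.
pose k := w c / u c.
have k0 : 0 < k.
  apply: lt_le_trans (_ : w x0 / u x0 <= k); last by rewrite -lerN2 cmax.
  rewrite divr_gt0 ?pos // /w x0E exprn_gt0 // /g.
  by have : 0 < (2^-1 : R) by []; nra.
have kc : k * u c = w c by rewrite divfK // lt0r_neq0.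
have wc : 0 < w c by rewrite -kc mulr_gt0.
have gc : g (logsq c) != 0.
  by apply: contraTneq wc; rewrite /w => ->; rewrite expr0n ltxx.
have cI : s1 < logsq c < s1 + 1.
  move: gc; rewrite /g mulf_eq0 negb_or !subr_eq0 => /andP[h1 h2].
  by rewrite !lt_neqAle (andP cA).1 (andP cA).2 eq_sym h1 eq_sym h2.
have c2 : 2 <= logsq c by rewrite (le_trans s12) // (andP cA).1.
have [_ _ tu] := upos c c2.
have [tw Lwc] := Lw c (lt_le_trans s1_gt0 (andP cA).1).
have [t Lt] := twice_partialB k tu tw.
have := laplacian_ge0_at_min t; rewrite Lt Lwc => Lge0.
have {Lge0} : 0 <= k * laplacian u c - 4 * expR (- logsq c) *
   (2 * (1 - 2 * (logsq c - s1)) ^+ 2 - 4 * g (logsq c) +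
    mu * (2 * g (logsq c) * (1 - 2 * (logsq c - s1)))).
  apply: Lge0; apply: filterS (annulus_nbhs s1_gt0 cI) => y yA.
  rewrite -/(w c) -/(w y) kc subrr subr_ge0 -ler_pdivrMr ?pos //.
  by rewrite -lerN2 cmax.
apply/negP; rewrite -ltNge.
have Lu := HS c (le_trans s1S (andP cA).1) c2.
have kL : k * laplacian u c <=
    - (4 * (mu ^+ 2 + 17) * expR (- logsq c) * g (logsq c) ^+ 2).
  rewrite -[g _ ^+ 2]/(w c) -kc lerNr -mulrN.
  by rewrite mulrCA ler_pM2l.
set E := expR _ in Lu kL *.
have E0 : 0 < E by exact: expR_gt0.
apply: (@le_lt_trans _ _ (- (4 * E * ((mu * g (logsq c) +
    (1 - 2 * (logsq c - s1))) ^+ 2 + (1 - 4 * g (logsq c)) ^+ 2 +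
    g (logsq c) ^+ 2)))).
  apply: le_trans (lerB kL (lexx _)) _; rewrite le_eqVlt; apply/orP; left.
  by apply/eqP; rewrite /g; ring.
rewrite oppr_lt0 mulr_gt0 // ?mulr_gt0 // ltr_wpDl ?exprn_even_gt0 //.
by rewrite addr_ge0 // sqr_ge0.
Qed.

(** * Iteration on one inequality of the system *)

(** Here [s / 2] is [ln |x|] and [e^(beta s / 2)] is [|x|^beta]. The exponent
[p] is used both as the full power of [u] and, after one factor [u] has been
kept apart, as that power minus 1. *)
Lemma source_lower_bound (R : realType) (mu beta tau p q a b c d s U V : R) :
  0 <= p -> 0 <= q -> 0 < c -> 0 < d -> 0 < s ->
  c * (expR (- (mu * s)) * s `^ a) <= U ->
  d * (expR (- (mu * s)) * s `^ b) <= V ->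
  (c `^ p * d `^ q * 2^-1 `^ tau) *
    (expR ((beta / 2 - mu * (p + q)) * s) * s `^ (tau + p * a + q * b)) <=
  expR (beta * s / 2) * (s / 2) `^ tau * U `^ p * V `^ q.
Proof.
move=> p0 q0 c0 d0 s0 HU HV.
have P0 r e : 0 < r -> 0 < r * (expR (- (mu * s)) * s `^ e).
  by move=> r0; rewrite !mulr_gt0 ?expR_gt0 ?powR_gt0.
have low r e W k : 0 < r -> 0 <= k -> r * (expR (- (mu * s)) * s `^ e) <= W ->
    r `^ k * expR (- (mu * s) * k) * s `^ (e * k) <= W `^ k.
  move=> r0 k0 HW.
  have -> : r `^ k * expR (- (mu * s) * k) * s `^ (e * k) =
      (r * (expR (- (mu * s)) * s `^ e)) `^ k.
    rewrite powRM ?ltW ?mulr_gt0 ?expR_gt0 ?powR_gt0 //.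
    by rewrite powRM ?expR_ge0 ?powR_ge0 // -expRM -powRrM mulrA.
  have rP := P0 r e r0.
  by apply: ge0_ler_powR => //; rewrite nnegrE ltW // (lt_le_trans rP).
rewrite [(s / 2) `^ tau]powRM ?(ltW s0) ?invr_ge0 //.
have L0 r e k : 0 < r -> 0 <= r `^ k * expR (- (mu * s) * k) * s `^ (e * k).
  by move=> r0; rewrite !mulr_ge0 ?expR_ge0 ?powR_ge0.
have H := ler_pM (L0 c a p c0) (L0 d b q d0) (low _ _ _ _ c0 p0 HU)
  (low _ _ _ _ d0 q0 HV).
rewrite -[X in _ <= X]mulrA.
apply: le_trans (ler_wpM2l _ H); last first.
  by rewrite !mulr_ge0 ?expR_ge0 ?powR_ge0.
rewrite le_eqVlt; apply/orP; left; apply/eqP.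
have s_neq0 : s != 0 by rewrite lt0r_neq0.
have -> : s `^ (tau + p * a + q * b) = s `^ tau * s `^ (a * p) * s `^ (b * q).
  by rewrite -!powRD ?s_neq0 ?implybT // [a * p]mulrC [b * q]mulrC.
have -> : expR ((beta / 2 - mu * (p + q)) * s) =
    expR (beta * s / 2) * expR (- (mu * s) * p) * expR (- (mu * s) * q).
  by rewrite -!expRD; congr expR; field.
by ring.
Qed.

(** One inequality of the system, in the variable [logsq x]. Exchanging [u]
and [v] also exchanges [p] and [q], so that both inequalities take this form. *)
Definition dominates_source (R : realType) (N : nat) (beta tau p q : R)
    (u v : 'rV[R]_N -> R) :=
  forall x, 2 <= logsq x ->
    expR (beta * logsq x / 2) * (logsq x / 2) `^ tau * u x `^ p * v x `^ q <=
    - laplacian u x.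

(** The power [s^0] is kept to match the shape [e^(- mu s) s^a] of the bounds
that the iteration improves. *)
Lemma fundamental_lower_bound (R : realType) (N : nat) (beta tau p q : R)
    (u v : 'rV[R]_N -> R) (mu := decay_rate R N) :
  0 < mu -> positive_outside u -> positive_outside v ->
  dominates_source beta tau p q u v ->
  exists2 c : R, 0 < c & forall x, 2 <= logsq x ->
    c * (expR (- (mu * logsq x)) * logsq x `^ 0) <= u x.
Proof.
move=> mu0 upos vpos uS; apply: (lower_bound mu0 upos (lexx 0) ltr01) => x x2.
rewrite mulr0 !mul0r; apply: lt_le_trans (uS x x2).
have [ux _ _] := upos x x2; have [vx _ _] := vpos x x2.
by rewrite !mulr_gt0 ?expR_gt0 ?powR_gt0 ?divr_gt0 // (lt_le_trans _ x2).
Qed.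

(** The critical condition makes the source at least of order
[e^(- (1 + mu) s) s^(tau + p a)], and [s^(tau + p a) >= s^(tau + a)] because
[p >= 1] and [s >= 1]. By lower_bound each step raises the power by
[tau + 1]. *)
Lemma critical_log_gain (R : realType) (N : nat) (beta tau p q : R)
    (u v : 'rV[R]_N -> R) (mu := decay_rate R N) (n : nat) :
  0 < mu -> positive_outside u -> positive_outside v ->
  dominates_source beta tau p q u v ->
  1 <= p -> 0 <= q -> - 1 < tau -> mu * (p + q) = beta / 2 + 1 + mu ->
  (exists2 d : R, 0 < d & forall x, 2 <= logsq x ->
    d * (expR (- (mu * logsq x)) * logsq x `^ 0) <= v x) ->
  exists2 c : R, 0 < c & forall x, 2 <= logsq x ->
    c * (expR (- (mu * logsq x)) * logsq x `^ (n%:R * (tau + 1))) <= u x.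
Proof.
move=> mu0 upos vpos uS p1 q0 tau1 crit [d d0 vd].
have t0 : 0 < tau + 1 by lra.
have p0 : 0 <= p by lra.
elim: n => [|n [c c0 uc]].
  by rewrite mul0r; exact: fundamental_lower_bound uS.
pose a := n%:R * (tau + 1); pose a' := n.+1%:R * (tau + 1).
have a0 : 0 <= a by rewrite mulr_ge0 // ltW.
have a'0 : 0 < a' by rewrite mulr_gt0.
have aa' : a' - 1 = a + tau by rewrite /a /a' -natr1; ring.
pose K := c `^ p * d `^ q * 2^-1 `^ tau.
have K0 : 0 < K by rewrite !mulr_gt0 ?powR_gt0 ?invr_gt0.
(* the factor 1/2 provides the strict inequality of lower_bound *)
have C0 : 0 < K / 2 / a' by rewrite !divr_gt0.
apply: (lower_bound mu0 upos (ltW a'0) C0) => x x2.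
have s0 : 0 < logsq x by apply: lt_le_trans x2.
rewrite divfK ?lt0r_neq0 //; apply: lt_le_trans (uS x x2).
have := source_lower_bound beta tau p0 q0 c0 d0 s0 (uc x x2) (vd x x2).
rewrite -/K; apply: lt_le_trans.
have -> : beta / 2 - mu * (p + q) = - (1 + mu) by rewrite crit; ring.
rewrite -/mu mulNr; clearbody K; rewrite -!mulrA.
set E := expR _; have E0 : 0 < E by exact: expR_gt0.
rewrite ltr_pM2l //.
have s1 : 1 <= logsq x by apply: le_trans x2; rewrite lerDl.
have Ps : 0 < logsq x `^ (a' - 1) by rewrite powR_gt0.
apply: (@lt_le_trans _ _ (E * logsq x `^ (a' - 1))).
  by rewrite gtr_pMl ?mulr_gt0 // invf_lt1 // ltr1n.
rewrite ler_pM2l // ler_powR // aa' mulr0 addr0 addrC lerD2l -/a.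
by rewrite ler_peMl.
Qed.

(** With one factor [u] kept apart, the source is [u] times a potential of
order at least [e^((theta - 1) s) s^(tau + (p - 1) a + q b)], which outgrows
every multiple of [e^(-s)]; linear_nonexistence then applies. *)
Lemma source_nonexistence (R : realType) (N : nat) (beta tau p q a b : R)
    (u v : 'rV[R]_N -> R) (mu := decay_rate R N)
    (theta := beta / 2 + 1 + mu - mu * (p + q)) :
  0 < mu -> positive_outside u -> dominates_source beta tau p q u v ->
  1 <= p -> 0 <= q ->
  (exists2 c : R, 0 < c & forall x, 2 <= logsq x ->
    c * (expR (- (mu * logsq x)) * logsq x `^ a) <= u x) ->
  (exists2 d : R, 0 < d & forall x, 2 <= logsq x ->
    d * (expR (- (mu * logsq x)) * logsq x `^ b) <= v x) ->
  0 < theta \/ theta = 0 /\ 0 < tau + (p - 1) * a + q * b -> False.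
Proof.
move=> mu0 upos uS p1 q0 [c c0 uc] [d d0 vd] growth.
have N0 : (0 < N)%N.
  by rewrite lt0n; apply: contraTneq mu0 => N0; rewrite /mu /decay_rate N0; lra.
have p10 : 0 <= p - 1 by lra.
apply: (linear_nonexistence N0 upos) => M.
pose K := c `^ (p - 1) * d `^ q * 2^-1 `^ tau.
have K0 : 0 < K by rewrite !mulr_gt0 ?powR_gt0 ?invr_gt0.
have [S HS] := expR_pow_growth (M / K) growth.
exists S => x xS x2.
have s0 : 0 < logsq x by apply: lt_le_trans x2.
have [ux _ _] := upos x x2.
apply: le_trans (uS x x2).
have -> : u x `^ p = u x * u x `^ (p - 1).
  by rewrite mulr_powRB1 ?ltW //; lra.
have low := source_lower_bound beta tau p10 q0 c0 d0 s0 (uc x x2) (vd x x2).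
rewrite -/K in low.
rewrite mulrCA -!mulrA [u x * _]mulrC !mulrA ler_pM2r //.
apply: le_trans low.
have -> : expR ((beta / 2 - mu * (p - 1 + q)) * logsq x) =
    expR (theta * logsq x) * expR (- logsq x).
  by rewrite -expRD; congr expR; rewrite /theta; ring.
have := HS _ xS s0; rewrite ler_pdivrMr // => HM.
apply: le_trans (ler_wpM2r (expR_ge0 (- logsq x)) HM) _.
by rewrite le_eqVlt; apply/orP; left; apply/eqP; ring.
Qed.

(** * The system *)

Lemma expR_half_logsq (R : realType) (N : nat) (x : 'rV[R]_N) :
  2 <= logsq x -> enorm x = expR (logsq x / 2).
Proof.
move=> x2; rewrite /enorm -/(sqnorm x) -expR_logsq ?(lt_le_trans _ x2) //.
have -> : expR (logsq x) = expR (logsq x / 2) ^+ 2.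
  by rewrite -expRM_natl; congr expR; field.
by rewrite sqrtr_sqr ger0_norm ?expR_ge0.
Qed.

Lemma twice_partial_Ck (R : realType) (N : nat) (U : set 'rV[R]_N)
    (f : 'rV[R]_N -> R) (x : 'rV[R]_N) :
  open U -> is_Ck 2 U f -> U x -> {for x, continuous f} /\ twice_partial f x.
Proof.
move=> oU [cf df] Ux; split; first exact: cf.
move=> i; have [d1 [_ /(_ i)[d2 _]]] := df i; split; last exact: d2.
have nU : \forall y \near x, U y by exact: open_nbhs_nbhs.
by apply: filterS nU => y; exact: d1.
Qed.

Lemma critical_exponent (R : realType) (N : nat) (beta : R) :
  (3 <= N)%N ->
  decay_rate R N * pstar N beta = beta / 2 + 1 + decay_rate R N.
Proof.
move=> N3; have : 3 <= N%:R :> R by rewrite ler_nat.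
by rewrite /decay_rate /pstar => N3'; field; lra.
Qed.

Lemma exists_natr_gt0 (R : realType) (tau k : R) :
  0 < k -> exists n : nat, 0 < tau + n%:R * k.
Proof.
move=> k0; exists (Num.bound `|tau / k|).
have := archi_boundP (normr_ge0 (tau / k)).
set n := _%:R => Hn; have : - (tau / k) < n.
  by apply: le_lt_trans Hn; rewrite -normrN ler_norm.
by rewrite -mulNr ltr_pdivrMr // => ?; lra.
Qed.

Theorem proposition4p3 (R : realType) (N : nat) (hN : (3 <= N)%N)
  (Omega : set 'rV[R]_N) (hOmega : exterior_domain Omega)
  (hext : ~` eball (expR 1) `<=` Omega)
  (h1 h2 : 'rV[R]_N -> R -> R -> R)
  (p1 q1 p2 q2 beta1 beta2 tau1 tau2 : R)
  (hp1 : 1 <= p1) (hq2 : 1 <= q2) (hp2 : 0 <= p2) (hq1 : 0 <= q1)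
  (hbeta1 : - 2 < beta1) (hbeta2 : - 2 < beta2)
  (hh1 : forall (x : 'rV[R]_N) (s t : R),
     (~` eball (expR 1)) x -> 0 <= s -> 0 <= t ->
     h1 x s t = enorm x `^ beta1 * ln (enorm x) `^ tau1 * s `^ p1 * t `^ q1)
  (hh2 : forall (x : 'rV[R]_N) (s t : R),
     (~` eball (expR 1)) x -> 0 <= s -> 0 <= t ->
     h2 x s t = enorm x `^ beta2 * ln (enorm x) `^ tau2 * s `^ p2 * t `^ q2)
  (hcond :
     [\/ p1 + q1 < pstar N beta1,
         p2 + q2 < pstar N beta2,
         [/\ p1 + q1 = pstar N beta1, p2 + q2 = pstar N beta2,
             1 < p1 & - 1 < tau1] |
         [\/ [/\ p1 + q1 = pstar N beta1, p2 + q2 = pstar N beta2,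
             1 < q2 & - 1 < tau2] |
         [/\ p1 + q1 = pstar N beta1, p2 + q2 = pstar N beta2,
             - 1 < tau1 & - 1 < tau2]]]) :
  ~ exists u v : 'rV[R]_N -> R, positive_supersolution Omega h1 h2 u v.
Proof.
move=> [u [v [Cu Cv uv]]].
have oO : open Omega.
  by have [C [_ clC _ ->]] := hOmega; exact: closed_openC.
have out (x : 'rV[R]_N) : 2 <= logsq x -> (~` eball (expR 1)) x.
  move=> x2; rewrite /eball /= expR_half_logsq // ltr_expR; apply/negP.
  by rewrite -leNgt ler_pdivlMr // mul1r.
have Ox x : 2 <= logsq x -> Omega x by move=> /out /hext.
pose mu := decay_rate R N.
have mu0 : 0 < mu.
  have : 3 <= N%:R :> R by rewrite ler_nat.
  by rewrite /mu /decay_rate => ?; lra.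
have upos : positive_outside u.
  move=> x x2; have [] := twice_partial_Ck oO Cu (Ox x x2).
  by have [] := uv x (Ox x x2).
have vpos : positive_outside v.
  move=> x x2; have [] := twice_partial_Ck oO Cv (Ox x x2).
  by have [] := uv x (Ox x x2).
have enormE (x : 'rV[R]_N) (b t : R) : 2 <= logsq x ->
    enorm x `^ b * ln (enorm x) `^ t =
    expR (b * logsq x / 2) * (logsq x / 2) `^ t.
  move=> x2; rewrite expR_half_logsq // expRK -expRM.
  by congr (expR _ * _); rewrite mulrC mulrA.
have uS : dominates_source beta1 tau1 p1 q1 u v.
  move=> x x2; have [ux vx + _] := uv x (Ox x x2).
  by rewrite (hh1 _ _ _ (out x x2) (ltW ux) (ltW vx)) enormE.
have vS : dominates_source beta2 tau2 q2 p2 v u.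
  move=> x x2; have [ux vx _ +] := uv x (Ox x x2).
  by rewrite (hh2 _ _ _ (out x x2) (ltW ux) (ltW vx)) enormE // mulrAC.
have u_low := fundamental_lower_bound mu0 upos vpos uS.
have v_low := fundamental_lower_bound mu0 vpos upos vS.
have crit1 := critical_exponent beta1 hN.
have crit2 := critical_exponent beta2 hN.
rewrite -/mu in u_low v_low crit1 crit2.
have hp1q1 : p1 + q1 = pstar N beta1 -> mu * (p1 + q1) = beta1 / 2 + 1 + mu.
  by move=> ->.
have hq2p2 : p2 + q2 = pstar N beta2 -> mu * (q2 + p2) = beta2 / 2 + 1 + mu.
  by rewrite addrC => ->.
have u_gain n c := critical_log_gain n mu0 upos vpos uS hp1 hq1 c.
have v_gain n c := critical_log_gain n mu0 vpos upos vS hq2 hp2 c.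
case: hcond => [sub|sub|[e1 e2 p1_gt1 t1]|[[e1 e2 q2_gt1 t2]|[e1 e2 t1 t2]]].
- apply: (source_nonexistence mu0 upos uS hp1 hq1 u_low v_low); left.
  by rewrite -/mu -crit1 -mulrBr mulr_gt0 // subr_gt0.
- apply: (source_nonexistence mu0 vpos vS hq2 hp2 v_low u_low); left.
  by rewrite -/mu -crit2 -mulrBr mulr_gt0 // subr_gt0 addrC.
- have k0 : 0 < (p1 - 1) * (tau1 + 1) by rewrite mulr_gt0 //; lra.
  have [n Hn] := exists_natr_gt0 tau1 k0.
  apply: (source_nonexistence mu0 upos uS hp1 hq1
    (u_gain n t1 (hp1q1 e1) v_low) v_low); right.
  rewrite -/mu (hp1q1 e1) subrr; split=> //.
  by rewrite mulr0 addr0 mulrCA.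
- have k0 : 0 < (q2 - 1) * (tau2 + 1) by rewrite mulr_gt0 //; lra.
  have [n Hn] := exists_natr_gt0 tau2 k0.
  apply: (source_nonexistence mu0 vpos vS hq2 hp2
    (v_gain n t2 (hq2p2 e2) u_low) u_low); right.
  rewrite -/mu (hq2p2 e2) subrr; split=> //.
  by rewrite mulr0 addr0 mulrCA.
- (* [p* > 1], since [beta1 > -2] *)
  have pq : 0 < (p1 - 1) + q1.
    rewrite -(pmulr_rgt0 _ mu0) addrAC mulrBr (hp1q1 e1) mulr1; lra.
  have k0 : 0 < (p1 - 1) * (tau1 + 1) + q1 * (tau2 + 1).
    have [p1_gt1|p1_le1] := ltP 1 p1.
      have ? : 0 < (p1 - 1) * (tau1 + 1) by rewrite mulr_gt0 //; lra.
      by rewrite ltr_pwDl // mulr_ge0 //; lra.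
    have ? : 0 < q1 * (tau2 + 1) by rewrite mulr_gt0 //; lra.
    by rewrite ltr_wpDl // mulr_ge0 //; lra.
  have [n Hn] := exists_natr_gt0 tau1 k0.
  apply: (source_nonexistence mu0 upos uS hp1 hq1
    (u_gain n t1 (hp1q1 e1) v_low) (v_gain n t2 (hq2p2 e2) u_low)); right.
  rewrite -/mu (hp1q1 e1) subrr; split=> //.
  move: Hn; congr (0 < _); ring.
Qed.
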